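(* Let $T>0$ and let $\omega\colon[0,T]\to[0,\infty)$ be a continuous non-negative function such that the function $$t\mapsto\Big(\omega_t+\int_0^t\omega_s^{1/2}\,ds\Big)^{-1/2}$$ belongs to $L^1([0,T])$. Then there exists a unique solution to the equation $$x_t=\int_0^t\sqrt{|x_s|}\,ds+\omega_t,\qquad t\in[0,T].$$
   Context: A solution is a continuous function $x\colon[0,T]\to\mathbb R$ satisfying the equation for all $t\in[0,T]$. *)

(* Defs.v *)
From HB Require Import structures.
From mathcomp Require Import all_boot all_order all_algebra.
From mathcomp Require Import all_classical all_reals all_analysis.

Set Implicit Arguments.
Unset Strict Implicit.
Unset Printing Implicit Defensive.

Import Order.TTheory GRing.Theory Num.Theory.
Import numFieldNormedType.Exports.

Local Open Scope classical_set_scope.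
Local Open Scope ring_scope.

(* The inverse is taken in \bar R, where 0^-1 = +oo. In R, where 0^-1 = 0, the
   points at which the base vanishes would contribute nothing to the integral,
   and omega = 0 would wrongly become admissible. *)
Definition inv_sqrt_weight (R : realType) (omega : R -> R) (t : R) : \bar R :=
  ((Num.sqrt (omega t +
     \int[lebesgue_measure]_(s in `[0, t]) Num.sqrt (omega s)))%:E^-1)%E.

(* Only the values of omega and x on [0, T] matter. *)
Definition is_solution (R : realType) (T : R) (omega x : R -> R) : Prop :=
  {within `[0, T], continuous x} /\
  forall t : R, t \in `[0, T] ->
    x t = (\int[lebesgue_measure]_(s in `[0, t]) Num.sqrt `|x s|) + omega t.

(* Main.v *)
Require Import Defs.
From HB Require Import structures.
From mathcomp Require Import all_boot all_order all_algebra.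
From mathcomp Require Import all_classical all_reals all_analysis.
From mathcomp Require Import measurable_realfun ring lra.
Set Implicit Arguments.
Unset Strict Implicit.
Unset Printing Implicit Defensive.
Import Order.TTheory GRing.Theory Num.Theory.
Import numFieldNormedType.Exports.
Local Open Scope classical_set_scope.
Local Open Scope ring_scope.

(** The solutions are the fixed points of the map
    [volterra omega : u |-> int_0^t sqrt |u| + omega_t]. This map is monotone
    in [|u|], and it sends some large constant [M] below itself because the
    square root grows sublinearly. Hence its iterates from 0 increase and stay
    below [M]; by dominated convergence their pointwise limit is a fixed point,
    and by monotonicity it lies below every other solution ([minimal_solution]).

    For uniqueness it remains to compare the minimal solution [x] with a solution
    [y >= x]. Write [w_t = omega_t + int_0^t sqrt omega]. Every solution dominates
    [omega], and feeding this back into the equation shows that it dominates [w].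
    So, with [D = y - x],
      [sqrt y - sqrt x = D / (sqrt y + sqrt x) <= D / sqrt w]
    and the square root is Lipschitz along the solutions with the integrable
    constant [w^{-1/2}]. Since [D' = sqrt y - sqrt x >= 0], the gap [D] is
    nondecreasing, and if it vanishes at [s] then
      [D_t <= int_s^t D_r w_r^{-1/2} dr <= D_t * int_s^t w_r^{-1/2} dr]
    ([gap_le]). By absolute continuity of the integral the last factor is less
    than 1 as soon as [t - s] is below a fixed threshold, which forces [D_t = 0].
    Starting from [D_0 = 0], finitely many such steps cover [[0, T]]
    ([ordered_solutions_eq]); this replaces an L^1 version of Gronwall's lemma. *)

(** * The integral operator and its minimal fixed point *)

Definition volterra (R : realType) (omega u : R -> R) (t : R) : R :=
  (\int[lebesgue_measure]_(s in `[0, t]) Num.sqrt `|u s|) + omega t.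

Section Volterra.
Context (R : realType).
Notation mu := (@lebesgue_measure R).
Implicit Types (T t M : R) (omega u v : R -> R).

Lemma subset_itv0 T t : t \in `[0, T] -> `[0, t] `<=` `[0, T].
Proof.
by rewrite in_itv/= => /andP[_ tT]; apply: subset_itvl; rewrite bnd_simp.
Qed.

(** [sqrt a <= 1 + a], and constants are integrable on a bounded interval. *)
Lemma sqrt_norm_integrable T u : mu.-integrable `[0, T] (EFin \o u) ->
  mu.-integrable `[0, T] (EFin \o (fun s => Num.sqrt `|u s|)).
Proof.
move=> iu.
apply: (@le_integrable _ _ _ mu _ _ _ (EFin \o (fun s => 1 + `|u s|))) => //.
- apply/measurable_EFinP.
  apply: (measurable_comp (F := setT) (f := @Num.sqrt R)) => //.
    exact: continuous_measurable_fun (@sqrt_continuous R).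
  apply: measurableT_comp => //.
  by apply/measurable_EFinP; exact: measurable_int iu.
- move=> s _ /=; rewrite lee_fin ger0_norm ?sqrtr_ge0//.
  rewrite [leRHS]ger0_norm ?addr_ge0//.
  rewrite -[X in _ <= _ + X]sqr_sqrtr ?normr_ge0//.
  have := sqrtr_ge0 `|u s|; move: (Num.sqrt _) => a a0.
  by have := sqr_ge0 (a - 1); rewrite sqrrB expr1n mulr1; lra.
- have -> : EFin \o (fun s => 1 + `|u s|) =
      (EFin \o cst (1 : R)) \+ (EFin \o (fun s => `|u s|)) by apply/funext.
  apply: integrableD => //; last exact: integrable_norm.
  apply: continuous_compact_integrable; first exact: segment_compact.
  by apply: continuous_subspaceT => ?; exact: cvg_cst.
Qed.

Lemma sqrt_norm_integrable_sub T u t : t \in `[0, T] ->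
  mu.-integrable `[0, T] (EFin \o u) ->
  mu.-integrable `[0, t] (EFin \o (fun s => Num.sqrt `|u s|)).
Proof.
move=> tT iu; apply: integrableS (sqrt_norm_integrable iu) => //.
exact: subset_itv0.
Qed.

Lemma volterra_ge omega u t : omega t <= volterra omega u t.
Proof.
by rewrite /volterra lerDr Rintegral_ge0// => s _; rewrite sqrtr_ge0.
Qed.

Lemma le_volterra omega u v T :
  mu.-integrable `[0, T] (EFin \o u) -> mu.-integrable `[0, T] (EFin \o v) ->
  (forall s, s \in `[0, T] -> `|u s| <= `|v s|) ->
  forall t, t \in `[0, T] -> volterra omega u t <= volterra omega v t.
Proof.
move=> iu iv uv t tT; rewrite /volterra lerD2r; apply: le_Rintegral => //.
- exact: (sqrt_norm_integrable_sub tT iu).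
- exact: (sqrt_norm_integrable_sub tT iv).
- by move=> s /(subset_itv0 tT)/= /uv; exact: ler_wsqrtr.
Qed.

Lemma volterra_continuous omega u T : 0 <= T ->
  {within `[0, T], continuous omega} ->
  mu.-integrable `[0, T] (EFin \o u) ->
  {within `[0, T], continuous (volterra omega u)}.
Proof.
move=> T0 co iu; apply: within_continuousD => //.
by apply: parameterized_integral_continuous => //; exact: sqrt_norm_integrable.
Qed.

(** [C + T sqrt M <= M] holds for large [M], where [C] bounds [omega]. *)
Lemma volterra_cst_bound omega T : 0 <= T ->
  {within `[0, T], continuous omega} ->
  exists2 M : R, 0 <= M &
    forall t, t \in `[0, T] -> volterra omega (fun=> M) t <= M.
Proof.
move=> T0 co; have [c _ cmax] := EVT_max T0 co.
(* With M = k ^+ 2 the claim reads C + T k <= k ^+ 2. *)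
pose k := 1 + T + `|omega c|.
have k0 : 0 <= k by rewrite /k !addr_ge0.
exists (k ^+ 2) => [|t tT]; first exact: sqr_ge0.
rewrite /volterra Rintegral_cst//= lebesgue_measure_itv/=.
rewrite ger0_norm ?sqr_ge0//.
rewrite sqrtr_sqr ger0_norm//.
have -> : fine (if (0 < t%:E)%E then (t%:E - 0)%E else 0%E) = t.
  move: tT; rewrite in_itv/= lte_fin le_eqVlt => /andP[/predU1P[<-|t0] _].
    by rewrite ltxx.
  by rewrite t0/= subr0.
have wc : omega t <= `|omega c| := le_trans (cmax _ tT) (ler_norm _).
move: tT; rewrite in_itv/= => /andP[t0 tT].
have := normr_ge0 (omega c); rewrite /k; set C := `|_| in wc *; nra.
Qed.

Lemma solution_volterra T omega y : is_solution T omega y ->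
  mu.-integrable `[0, T] (EFin \o y) /\
  forall t, t \in `[0, T] -> y t = volterra omega y t.
Proof.
move=> [cy ey]; split=> //.
by apply: continuous_compact_integrable => //; exact: segment_compact.
Qed.

(** Limit of the Picard iterates started at 0. Minimality is what lets the
    uniqueness proof treat only pairs of ordered solutions. *)
Lemma minimal_solution T omega : 0 <= T ->
  {within `[0, T], continuous omega} ->
  (forall t, t \in `[0, T] -> 0 <= omega t) ->
  exists x, is_solution T omega x /\
    forall y, is_solution T omega y ->
      forall t, t \in `[0, T] -> x t <= y t.
Proof.
move=> T0 co w0.
have [M M0 HM] := volterra_cst_bound T0 co.
pose U n := iter n (volterra omega) (fun=> 0).
have cU n : {within `[0, T], continuous (U n)} /\
            mu.-integrable `[0, T] (EFin \o U n).
  have cont_int u : {within `[0, T], continuous u} ->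
      mu.-integrable `[0, T] (EFin \o u).
    move=> cu; apply: continuous_compact_integrable => //.
    exact: segment_compact.
  elim: n => [|n [_ iUn]].
    have c0 : {within `[0, T], continuous (U 0%N)}.
      by apply: continuous_subspaceT => ?; exact: cvg_cst.
    by split=> //; exact: cont_int.
  by have c := volterra_continuous T0 co iUn; split => //; exact: cont_int.
have U0 n t : t \in `[0, T] -> 0 <= U n t.
  case: n => [//|n] tT; exact: le_trans (w0 _ tT) (volterra_ge _ _ _).
have leU n t : t \in `[0, T] -> U n t <= U n.+1 t.
  elim: n t => [|n IH] t tT; first exact: U0.
  apply: (@le_volterra omega (U n) (U n.+1) T) => //.
  - exact: (cU n).2.
  - exact: (cU n.+1).2.
  - by move=> s sT; rewrite !ger0_norm ?U0//; exact: IH.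
(* The iterates stay below every nonnegative supersolution: applied to M this
   bounds them, applied to a solution it gives minimality. *)
have Ule (v : R -> R) n t : mu.-integrable `[0, T] (EFin \o v) ->
    (forall s, s \in `[0, T] -> 0 <= v s) ->
    (forall s, s \in `[0, T] -> volterra omega v s <= v s) ->
    t \in `[0, T] -> U n t <= v t.
  move=> iv v0 Hv; elim: n t => [|n IH] t tT; first exact: v0.
  apply: le_trans (Hv _ tT).
  apply: (@le_volterra omega (U n) v T) => //; first exact: (cU n).2.
  by move=> s sT; rewrite !ger0_norm ?U0 ?v0//; exact: IH.
have icst (k : R) t : mu.-integrable `[0, t] (EFin \o (fun=> k)).
  apply: continuous_compact_integrable; first exact: segment_compact.
  by apply: continuous_subspaceT => ?; exact: cvg_cst.
have UM n t : t \in `[0, T] -> U n t <= M by exact: Ule.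
pose x t := sup (range (U ^~ t)).
have Ux t : t \in `[0, T] -> U ^~ t @ \oo --> x t.
  move=> tT; apply: nondecreasing_cvgn.
    by apply/nondecreasing_seqP => n; exact: leU.
  by exists M => _ [n _ <-]; exact: UM.
have x0 t : t \in `[0, T] -> 0 <= x t.
  move=> tT; rewrite -(cvg_lim _ (Ux t tT))//; apply: limr_ge.
    by apply/cvg_ex; exists (x t); exact: Ux.
  by near=> n; exact: U0.
have xv c t : t \in `[0, T] -> (forall n, U n t <= c) -> x t <= c.
  move=> tT Uv; rewrite -(cvg_lim _ (Ux t tT))//; apply: limr_le.
    by apply/cvg_ex; exists (x t); exact: Ux.
  by near=> n; exact: Uv.
have mx : measurable_fun `[0, T] x.
  apply: (@measurable_fun_cvg _ _ _ _ U) => // n.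
  by apply/measurable_EFinP; exact: measurable_int (cU n).2.
have ix : mu.-integrable `[0, T] (EFin \o x).
  apply: (@le_integrable _ _ _ _ _ _ _ (EFin \o (fun=> M))) => //.
    exact/measurable_EFinP.
  move=> t tT /=; rewrite lee_fin !ger0_norm ?x0//.
  by apply: xv => // n; exact: UM.
have fix_x t : t \in `[0, T] -> x t = volterra omega x t.
  move=> tT; suff : U ^~ t @ \oo --> volterra omega x t.
    by move/(norm_cvg_unique (Ux _ tT)).
  rewrite -cvg_shiftS; apply: cvgD; last exact: cvg_cst.
  have ifx := sqrt_norm_integrable_sub tT ix.
  have [] := @dominated_convergence _ _ R mu `[0, t] _
    (fun n => EFin \o (fun s => Num.sqrt `|U n s|))
    (EFin \o (fun s => Num.sqrt `|x s|)) (EFin \o (fun=> Num.sqrt M)).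
  - by [].
  - by move=> n; exact: measurable_int (sqrt_norm_integrable_sub tT (cU n).2).
  - exact: measurable_int ifx.
  - apply: aeW => s /(subset_itv0 tT) sT; apply: cvg_EFin; first by near=> n.
    apply: continuous_cvg; first exact: sqrt_continuous.
    by apply: cvg_norm; exact: Ux.
  - exact: icst.
  - apply: aeW => s n /(subset_itv0 tT) sT /=.
    by rewrite lee_fin ger0_norm ?sqrtr_ge0// ler_wsqrtr// ger0_norm ?U0// UM.
  move=> _ _ h; apply: fine_cvg; rewrite fineK; first exact: h.
  exact: integrable_fin_num.
have sx : is_solution T omega x.
  split=> //.
  apply: (@subspace_eq_continuous _ _ _ (volterra omega x)).
    by move=> t /set_mem tT; apply/esym/fix_x.
  exact: volterra_continuous.
exists x; split=> // y ys t tT; have [iy ey] := solution_volterra ys.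
apply: xv => // n; apply: Ule => // s sT.
  by rewrite ey//; exact: le_trans (w0 _ sT) (volterra_ge _ _ _).
by rewrite -ey.
Unshelve. all: by end_near.
Qed.

End Volterra.

(** * Auxiliary estimates *)

(** Absolute continuity of the integral for an extended-real integrand. Such an
    integrand is almost everywhere finite, so it may be replaced by a real
    function, equal to [fine \o g] on [E] and to 0 outside. *)
Lemma ge0_integral_absolutely_continuous (d : measure_display)
    (X : measurableType d) (R : realType) (mu : {measure set X -> \bar R})
    (E : set X) (g : X -> \bar R) :
  measurable E -> mu.-integrable E g -> (forall x, E x -> (0 <= g x)%E) ->
  forall e : R, 0 < e -> exists2 r : R, 0 < r &
    forall A, measurable A -> A `<=` E -> (mu A < r%:E)%E ->
      (\int[mu]_(x in A) g x < e%:E)%E.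
Proof.
move=> mE ig g0 e e0.
pose f := fine \o (g \_ E).
have /(integrable_mkcond _ mE) igE := ig.
have mf : measurable_fun setT (EFin \o f).
  apply/measurable_EFinP; apply: measurableT_comp => //.
  exact: measurable_int igE.
have If : mu.-integrable setT (EFin \o f).
  apply: le_integrable igE => // x _ /=; rewrite /f/=.
  by case: ((g \_ E) x) => [r||] /=; rewrite ?normr0 ?leey.
have [r [r0 Hr]] := integral_normr_continuous If e0.
exists r => // A mA AE muA; have := Hr A mA muA.
have IfA : mu.-integrable A (EFin \o (fun x => `|f x|)).
  by apply: integrable_norm; exact: integrableS If.
rewrite -lte_fin /Rintegral fineK; last exact: integrable_fin_num.
apply: le_lt_trans; rewrite le_eqVlt; apply/orP; left; apply/eqP.
apply: ge0_ae_eq_integral => //.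
- by apply: measurable_funS AE _ => //; exact: measurable_int ig.
- exact: measurable_int IfA.
- by move=> x /AE; exact: g0.
apply: filterS (integrable_ae mE ig) => x gx Ax.
have Ex := AE _ Ax.
rewrite /f /= patchE mem_set// ger0_norm ?fine_ge0 ?g0// fineK//; exact: gx.
Qed.

(** The quotient [(b - a) / (sqrt b + sqrt a)], with a denominator at least
    [sqrt w]. In [\bar R] this survives [w = 0], where the bound is [+oo] unless
    [a = b], in which case both sides are 0; the times at which the weight
    is infinite thus need no separate treatment. *)
Lemma subr_sqrt_le (R : realType) (w a b : R) : 0 <= w -> w <= a -> a <= b ->
  ((Num.sqrt b - Num.sqrt a)%:E <= (b - a)%:E * (Num.sqrt w)%:E^-1)%E.
Proof.
move=> w0 wa ab; have a0 := le_trans w0 wa; have b0 := le_trans a0 ab.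
have [<-|b_neq] := eqVneq a b; first by rewrite !subrr mul0e.
have ab' : 0 < b - a by rewrite subr_gt0 lt_neqAle b_neq.
have [sw0|sw_neq] := eqVneq (Num.sqrt w) 0.
  by rewrite inver sw0 eqxx gt0_muley ?lte_fin// leey.
have sw : 0 < Num.sqrt w by rewrite lt_neqAle eq_sym sw_neq sqrtr_ge0.
rewrite inver (negPf sw_neq) -EFinM lee_fin ler_pdivlMr//.
have hwa : Num.sqrt w <= Num.sqrt a by exact: ler_wsqrtr.
have hab : Num.sqrt a <= Num.sqrt b by exact: ler_wsqrtr.
rewrite -{2}(sqr_sqrtr a0) -{2}(sqr_sqrtr b0).
move: (Num.sqrt w) (Num.sqrt a) (Num.sqrt b) sw hwa hab => p q r p0 pq qr.
by rewrite subr_sqr ler_wpM2l ?subr_ge0//; lra.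
Qed.

(** * Comparison of two solutions *)

Section Uniqueness.
Context (R : realType) (T : R) (omega : R -> R).
Notation mu := (@lebesgue_measure R).
Context (omega_cont : {within `[0, T], continuous omega})
  (omega_ge0 : forall t : R, t \in `[0, T] -> 0 <= omega t).

Lemma solution_ge_omega y : is_solution T omega y ->
  forall t, t \in `[0, T] -> omega t <= y t.
Proof.
by move=> /solution_volterra[_ ey] t tT; rewrite ey//; exact: volterra_ge.
Qed.

(** Inserting [omega <= y] under the integral of the equation improves the lower
    bound [omega] to the base of the weight. *)
Lemma solution_ge_weight y : is_solution T omega y ->
  forall t, t \in `[0, T] ->
  omega t + \int[mu]_(s in `[0, t]) Num.sqrt (omega s) <= y t.
Proof.
move=> ys t tT; have [iy ey] := solution_volterra ys.
have io : mu.-integrable `[0, T] (EFin \o omega).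
  by apply: continuous_compact_integrable => //; exact: segment_compact.
rewrite ey// addrC; apply: (@le_trans _ _ (volterra omega omega t)).
  rewrite lerD2r le_eqVlt; apply/orP; left; apply/eqP.
  apply: eq_Rintegral => s /set_mem /(subset_itv0 tT) sT.
  by rewrite ger0_norm// omega_ge0.
apply: (@le_volterra _ omega omega y T) => // s sT.
have wy := solution_ge_omega ys sT.
by rewrite !ger0_norm ?omega_ge0// (le_trans _ wy)// omega_ge0.
Qed.

Lemma weight_ge0 t : t \in `[0, T] ->
  0 <= omega t + \int[mu]_(s in `[0, t]) Num.sqrt (omega s).
Proof.
by move=> tT; rewrite addr_ge0 ?omega_ge0// Rintegral_ge0.
Qed.

Section Gap.
Context (x y : R -> R)
  (xs : is_solution T omega x) (ys : is_solution T omega y)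
  (xy : forall t, t \in `[0, T] -> x t <= y t).

(** The absolute values of the equation disappear since solutions are
    nonnegative. *)
Lemma gap_increment s t : 0 <= s -> s <= t -> t <= T ->
  mu.-integrable `]s, t] (EFin \o (fun r => Num.sqrt (y r) - Num.sqrt (x r))) /\
  (y t - x t) - (y s - x s) =
  \int[mu]_(r in `]s, t]) (Num.sqrt (y r) - Num.sqrt (x r)).
Proof.
move=> s0 st tT.
have [ix ex] := solution_volterra xs; have [iy ey] := solution_volterra ys.
have x_ge0 r : r \in `[0, T] -> 0 <= x r.
  by move=> rT; rewrite (le_trans (omega_ge0 rT))//; exact: solution_ge_omega.
have y_ge0 r : r \in `[0, T] -> 0 <= y r.
  by move=> rT; rewrite (le_trans (x_ge0 _ rT))//; exact: xy.
pose h r := Num.sqrt `|y r| - Num.sqrt `|x r|.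
have ih : mu.-integrable `[0, T] (EFin \o h).
  by apply: (@integrableB _ _ _ mu _ _ (EFin \o (fun r => Num.sqrt `|y r|))
    (EFin \o (fun r => Num.sqrt `|x r|))) => //; exact: sqrt_norm_integrable.
have gapE r : r \in `[0, T] -> y r - x r = \int[mu]_(q in `[0, r]) h q.
  move=> rT; rewrite ey// ex// /volterra RintegralB//.
  - by ring.
  - exact: sqrt_norm_integrable_sub rT iy.
  - exact: sqrt_norm_integrable_sub rT ix.
have tT' : t \in `[0, T] by rewrite in_itv/= tT (le_trans s0 st).
have sT' : s \in `[0, T] by rewrite in_itv/= s0 (le_trans st tT).
have st_sub : `]s, t] `<=` `[0, T].
  by apply: subset_itv; rewrite bnd_simp.
have hE : {in `]s, t], h =1 (fun r => Num.sqrt (y r) - Num.sqrt (x r))}.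
  by move=> r /st_sub rT; rewrite /h !ger0_norm ?x_ge0 ?y_ge0.
split.
  apply: (@eq_integrable _ _ _ mu _ _ (EFin \o h)) => //.
    by move=> r /set_mem rst /=; rewrite hE.
  exact: integrableS ih.
rewrite !gapE// Rintegral_itvB ?bnd_simp//.
  by apply: eq_Rintegral => r /set_mem rst; rewrite hE.
by apply: integrableS ih => //; exact: subset_itv0.
Qed.

Lemma gap_nondecreasing s t : 0 <= s -> s <= t -> t <= T ->
  y s - x s <= y t - x t.
Proof.
move=> s0 st tT; rewrite -subr_ge0; have [_ ->] := gap_increment s0 st tT.
apply: Rintegral_ge0 => r /=; rewrite in_itv/= => /andP[sr rt].
rewrite subr_ge0 ler_wsqrtr// xy// in_itv/=.
by rewrite (le_trans s0 (ltW sr)) (le_trans rt tT).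
Qed.

(** On [[s, t]] the monotone gap is at most its final value, which therefore
    factors out of the integral of [(y - x) / sqrt w]. *)
Lemma gap_le s t : 0 <= s -> s <= t -> t <= T -> y s = x s ->
  mu.-integrable `[0, T] (inv_sqrt_weight omega) ->
  ((y t - x t)%:E <=
   (y t - x t)%:E * \int[mu]_(r in `]s, t]) inv_sqrt_weight omega r)%E.
Proof.
move=> s0 st tT ysxs ig; have [ih incr] := gap_increment s0 st tT.
have st_sub : `]s, t] `<=` `[0, T] by apply: subset_itv; rewrite bnd_simp.
have gap0 : 0 <= y t - x t.
  by rewrite subr_ge0 xy// in_itv/= tT (le_trans s0 st).
have g0 r : `]s, t]%classic r -> (0 <= inv_sqrt_weight omega r)%E.
  by move=> _; rewrite /inv_sqrt_weight inve_ge0 lee_fin sqrtr_ge0.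
have mg : measurable_fun `]s, t] (inv_sqrt_weight omega).
  by apply: measurable_funS st_sub _ => //; exact: measurable_int ig.
rewrite -[X in (X%:E <= _)%E](subr0) -{1}(subrr (x s)) -{1}ysxs incr.
rewrite /Rintegral fineK; last exact: integrable_fin_num.
rewrite -ge0_integralZl_EFin//; apply: ge0_le_integral => //.
- move=> r /st_sub rT; rewrite lee_fin subr_ge0 ler_wsqrtr//; exact: xy.
- exact: measurable_int ih.
- exact: measurable_funeM.
move=> r rst; have rT := st_sub _ rst.
have wx := solution_ge_weight xs rT.
apply: le_trans (subr_sqrt_le (weight_ge0 rT) wx (xy rT)) _.
apply: lee_wpmul2r; first exact: g0.
move: rst rT; rewrite /= !in_itv/= => /andP[_ rt] /andP[r0 _].
by rewrite lee_fin; exact: gap_nondecreasing.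
Qed.

Lemma ordered_solutions_eq :
  mu.-integrable `[0, T] (inv_sqrt_weight omega) ->
  forall t, t \in `[0, T] -> y t = x t.
Proof.
move=> ig.
have g0 s : `[0, T]%classic s -> (0 <= inv_sqrt_weight omega s)%E.
  by move=> _; rewrite /inv_sqrt_weight inve_ge0 lee_fin sqrtr_ge0.
have [//|r r0 Hr] := ge0_integral_absolutely_continuous _ ig g0 (@ltr01 R).
(* A gap d >= 0 with d <= d * I and I < 1 vanishes. *)
have step s t : 0 <= s -> s <= t -> t <= T -> t - s < r -> y s = x s ->
    y t = x t.
  move=> s0 st tT tsr /(gap_le s0 st tT)/(_ ig).
  have tT' : t \in `[0, T] by rewrite in_itv/= tT (le_trans s0 st).
  have : (\int[mu]_(q in `]s, t]) inv_sqrt_weight omega q < 1%:E)%E.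
    apply: Hr => //; first by apply: subset_itv; rewrite bnd_simp.
    rewrite /= lebesgue_measure_itv/=; case: ifP => _; last by rewrite lte_fin.
    by rewrite -EFinB lte_fin.
  move=> int_lt1 le_gap; apply/eqP; rewrite eq_le xy// andbT leNgt.
  apply/negP => xt.
  have gap_gt0 : 0 < y t - x t by rewrite subr_gt0.
  move: le_gap; apply/negP; rewrite -ltNge.
  by rewrite -[X in (_ < X)%E]mule1 lte_pmul2l// lte_fin.
(* Steps have length r / 2, as the threshold r itself is excluded. *)
have eq_upto n t : t \in `[0, T] -> t <= n%:R * (r / 2) -> y t = x t.
  elim: n t => [|n IH] t tT tn.
    move: tT; rewrite in_itv/= => /andP[t0 tT].
    have [ix ex] := solution_volterra xs; have [iy ey] := solution_volterra ys.
    have t00 : t = 0.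
      by apply/eqP; rewrite eq_le t0 andbT; move: tn; rewrite mul0r.
    have t00T : 0 \in `[0, T] by rewrite in_itv/= lexx (le_trans t0).
    by rewrite t00 ey// ex// /volterra set_itv1 !Rintegral_set1.
  have [tn'|tn'] := leP t (n%:R * (r / 2)); first exact: IH.
  move: tT; rewrite in_itv/= => /andP[t0 tT].
  have nr0 : 0 <= n%:R * (r / 2) by rewrite mulr_ge0// divr_ge0// ltW.
  apply: (step (n%:R * (r / 2)) t) => //; first exact: ltW.
    by move: tn; rewrite -natr1; lra.
  by apply: IH => //; rewrite in_itv/= nr0 (le_trans (ltW tn')).
move=> t tT; apply: (eq_upto (Num.truncn (t / (r / 2))).+1) => //.
by rewrite -ler_pdivrMr ?divr_gt0// ltW// truncnS_gt.
Qed.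

End Gap.
End Uniqueness.

Theorem theorem3p5 (R : realType) (T : R) (omega : R -> R)
  (hT : 0 < T)
  (omega_cont : {within `[0, T], continuous omega})
  (omega_ge0 : forall t : R, t \in `[0, T] -> 0 <= omega t)
  (omega_L1 : lebesgue_measure.-integrable `[0, T] (inv_sqrt_weight omega)) :
  exists x : R -> R, is_solution T omega x /\
    (forall y : R -> R, is_solution T omega y ->
       forall t : R, t \in `[0, T] -> y t = x t).
Proof.
have [x [xs xmin]] := minimal_solution (ltW hT) omega_cont omega_ge0.
exists x; split=> // y ys.
exact: (ordered_solutions_eq omega_cont omega_ge0 xs ys (xmin y ys) omega_L1).
Qed.
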